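(* Fix integers $m\ge1$ and $k\ge1$. Let $\mathbb{Z}_{2^k,\mathrm{sym}}^{m\times m}$ be the additive group of symmetric $m\times m$ matrices whose diagonal entries are in $\mathbb{Z}_{2^k}$ and whose off-diagonal entries are in $\mathbb{Z}_{2^{k-1}}$, and let $\mathcal{C}_{d,\mathrm{sym}}^{(k)}=\{\tau_R^{(k)}: R\in\mathbb{Z}_{2^k,\mathrm{sym}}^{m\times m}\}$. Then $\mathcal{C}_{d,\mathrm{sym}}^{(k)}$ is a subgroup of $\mathcal{C}_d^{(k)}$. Furthermore, the map $\gamma:\mathcal{C}_{d,\mathrm{sym}}^{(k)}\to\mathbb{Z}_{2^k,\mathrm{sym}}^{m\times m}$ defined by $\gamma(\tau_R^{(k)})=R$ is a group isomorphism.
   Context: Let $N=2^m$, with standard basis $e_v=|v\rangle$ of $\mathbb{C}^N=(\mathbb{C}^2)^{\otimes m}$ indexed by row vectors $v\in\{0,1\}^m=\mathbb{Z}_2^m$. Let $X=\begin{bmatrix}0&1\\1&0\end{bmatrix}$, $Z=\begin{bmatrix}1&0\\0&-1\end{bmatrix}$, $\imath=\sqrt{-1}$. For $a,b\in\mathbb{Z}_2^m$ put $D(a,b)=X^{a_1}Z^{b_1}\otimes\cdots\otimes X^{a_m}Z^{b_m}$. The Pauli (Heisenberg-Weyl) group is $HW_N=\{\imath^{\kappa}D(a,b): \kappa\in\mathbb{Z}_4,\ a,b\in\mathbb{Z}_2^m\}$. Clifford hierarchy: $\mathcal{C}^{(1)}=HW_N$ and, for $k>1$, $\mathcal{C}^{(k)}=\{U\in\mathbb{U}_N: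 UD(a,b)U^\dagger\in\mathcal{C}^{(k-1)}\text{ for all }a,b\in\mathbb{Z}_2^m\}$, where $\mathbb{U}_N$ is the group of $N\times N$ unitary matrices. $\mathcal{C}_d^{(k)}$ denotes the set of diagonal matrices in $\mathcal{C}^{(k)}$; it is known (Cui, Gottesman and Krishna) that it is a group under multiplication. Let $\xi=\exp(2\pi\imath/2^k)$, and let $\mathbb{Z}_{2^k}$ be the ring of integers modulo $2^k$ ($\mathbb{Z}_{2^0}$ is the trivial ring). For $R\in\mathbb{Z}_{2^k,\mathrm{sym}}^{m\times m}$, $\tau_R^{(k)}=\sum_{v\in\mathbb{Z}_2^m}\xi^{vRv^T\bmod 2^k}|v\rangle\langle v|$, where $vRv^T=\sum_iR_{ii}v_i+2\sum_{i<j}R_{ij}v_iv_j$ is well defined modulo $2^k$. Addition in $\mathbb{Z}_{2^k,\mathrm{sym}}^{m\times m}$ is entrywise: modulo $2^k$ on the diagonal and modulo $2^{k-1}$ off the diagonal. *)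

(* Defs.v *)
From HB Require Import structures.
From mathcomp Require Import all_boot all_order all_algebra.
From mathcomp Require Import zify.
From mathcomp Require Import complex.
From mathcomp Require Import all_classical all_reals all_analysis.

Set Implicit Arguments.
Unset Strict Implicit.
Unset Printing Implicit Defensive.

Import Order.TTheory GRing.Theory Num.Theory.

Local Open Scope classical_set_scope.
Local Open Scope sesquilinear_scope.
Local Open Scope ring_scope.
Local Open Scope complex_scope.

(* Integers modulo n for every n > 0, the trivial group Z_1 included (whereas
   'Z_1 is the ring of integers modulo 2); addition is addition modulo n. *)
Notation Zmod n := 'I_(n.-1.+1).

Definition cexp (R : realType) (z : R[i]) : R[i] :=
  (expR (complex.Re z))%:C * (cos (complex.Im z) +i* sin (complex.Im z)).

Definition xi (R : realType) (k : nat) : R[i] :=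
  cexp (2 * pi%:C * 'i / 2 ^+ k).

(* Position x of the standard basis of C^(2^m) carries the row vector of the
   binary digits of x, most significant digit first. *)
Definition label (m : nat) (x : 'I_(2 ^ m)) : 'rV['Z_2]_m :=
  \row_(j < m) inZp (x %/ 2 ^ (m.-1 - j))%N.

Lemma label_bij (m : nat) : bijective (@label m).
Proof.
apply: inj_card_bij; last by rewrite card_mx card_ord mul1n card_ord.
move=> x y /rowP exy; apply/val_inj.
have dig (j : nat) : (j < m)%N ->
    ((x %/ 2 ^ j) %% 2 = (y %/ 2 ^ j) %% 2)%N.
  move=> ltjm; have ltj : (m.-1 - j < m)%N by lia.
  move/(_ (Ordinal ltj))/(congr1 val): exy; rewrite !mxE /=.
  by rewrite (_ : m.-1 - (m.-1 - j) = j)%N; last lia.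
suff low (n : nat) : (n <= m)%N -> (x %% 2 ^ n = y %% 2 ^ n)%N.
  by move: (low m (leqnn m)); rewrite !modn_small.
elim: n => [|n IHn] ltnm; first by rewrite !modn1.
have step (z : nat) :
    (z %% 2 ^ n.+1 = (z %/ 2 ^ n %% 2) * 2 ^ n + z %% 2 ^ n)%N.
  rewrite {1}(divn_eq z (2 ^ n)) {1}(divn_eq (z %/ 2 ^ n) 2).
  rewrite mulnDl -mulnA -expnS -addnA modnMDl modn_small //.
  have := ltn_pmod z (expn_gt0 2 n); have := ltn_pmod (z %/ 2 ^ n) (isT : 0 < 2)%N.
  by rewrite expnS; nia.
by rewrite !step dig // IHn // ltnW.
Qed.

Section Clifford.
Variables (R : realType) (m : nat).

Definition ket (v : 'rV['Z_2]_m) : 'cV[R[i]]_(2 ^ m) :=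
  \col_x (label x == v)%:R.

Definition tensor (A : 'I_m -> 'M[R[i]]_2) : 'M[R[i]]_(2 ^ m) :=
  \matrix_(x, y) \prod_(i < m) A i (label x 0 i) (label y 0 i).

Definition pauliX : 'M[R[i]]_2 := \matrix_(i, j) (i != j)%:R.

Definition pauliZ : 'M[R[i]]_2 := \matrix_(i, j) ((-1) ^+ i *+ (i == j)).

Definition pauliD (a b : 'rV['Z_2]_m) : 'M[R[i]]_(2 ^ m) :=
  tensor (fun i => pauliX ^+ a 0 i *m pauliZ ^+ b 0 i).

Definition HW : set 'M[R[i]]_(2 ^ m) :=
  [set U | exists (kappa : 'Z_4) (a b : 'rV['Z_2]_m),
             U = 'i ^+ kappa *: pauliD a b].

(* The hierarchy starts at level 1; level 0 is a dummy value. *)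
Fixpoint clifford (k : nat) : set 'M[R[i]]_(2 ^ m) :=
  match k with
  | 0 => set0
  | 1 => HW
  | k'.+1 => [set U | U \is unitarymx /\
               forall a b : 'rV['Z_2]_m,
                 clifford k' (U *m pauliD a b *m U ^t*)]
  end.

Definition clifford_diag (k : nat) : set 'M[R[i]]_(2 ^ m) :=
  [set U | clifford k U /\ is_diag_mx U].

End Clifford.

Arguments ket R {m} v.
Arguments clifford R m k : clear implicits.
Arguments clifford_diag R m k : clear implicits.

(* G is meant to be a group of invertible matrices under multiplication. *)
Definition mx_subgroup (F : fieldType) (n : nat) (H G : set 'M[F]_n) : Prop :=
  [/\ H `<=` G,
      H 1%:M,
      forall A B, H A -> H B -> H (A *m B) &
      forall A, H A -> H (invmx A)].

Section SymmetricMatrices.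
Variables (k m : nat).

Definition sym_modulus (i j : 'I_m) : nat :=
  if i == j then (2 ^ k)%N else (2 ^ (k - 1))%N.

(* Entries (i, j) and (j, i) have provably but not definitionally equal types,
   so symmetry compares their canonical representatives. *)
Record symmx := Symmx {
  symmx_val :> {dffun forall ij : 'I_m * 'I_m, Zmod (sym_modulus ij.1 ij.2)};
  symmxP : [forall i, forall j, symmx_val (i, j) == symmx_val (j, i) :> nat]
}.

HB.instance Definition _ := [isSub for symmx_val].
HB.instance Definition _ := [Choice of symmx by <:].

Implicit Types A B C : symmx.

Lemma sym_modulusC (i j : 'I_m) : sym_modulus i j = sym_modulus j i.
Proof. by rewrite /sym_modulus eq_sym. Qed.

Lemma symmxC A i j : A (i, j) = A (j, i) :> nat.
Proof. by apply/eqP; move/forallP/(_ i)/forallP: (symmxP A). Qed.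

Fact symmx_zero_subproof :
  let s := [ffun ij : 'I_m * 'I_m => 0 : Zmod (sym_modulus ij.1 ij.2)] :
    {dffun forall ij : 'I_m * 'I_m, Zmod (sym_modulus ij.1 ij.2)} in
  [forall i, forall j, s (i, j) == s (j, i) :> nat].
Proof. by apply/forallP=> i; apply/forallP=> j; rewrite !ffunE. Qed.

Fact symmx_opp_subproof A :
  let s := [ffun ij : 'I_m * 'I_m => - A ij] :
    {dffun forall ij : 'I_m * 'I_m, Zmod (sym_modulus ij.1 ij.2)} in
  [forall i, forall j, s (i, j) == s (j, i) :> nat].
Proof.
apply/forallP=> i; apply/forallP=> j; rewrite !ffunE /=.
by rewrite symmxC sym_modulusC.
Qed.

Fact symmx_add_subproof A B :
  let s := [ffun ij : 'I_m * 'I_m => A ij + B ij] :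
    {dffun forall ij : 'I_m * 'I_m, Zmod (sym_modulus ij.1 ij.2)} in
  [forall i, forall j, s (i, j) == s (j, i) :> nat].
Proof.
apply/forallP=> i; apply/forallP=> j; rewrite !ffunE /=.
apply/eqP; rewrite (symmxC A) (symmxC B).
by congr (_ %% _.-1.+1)%N; exact: sym_modulusC.
Qed.

Definition symmx_zero := Symmx symmx_zero_subproof.
Definition symmx_opp A := Symmx (symmx_opp_subproof A).
Definition symmx_add A B := Symmx (symmx_add_subproof A B).

Fact symmx_addA : associative symmx_add.
Proof. by move=> A B C; apply/val_inj/ffunP=> ij; rewrite !ffunE addrA. Qed.

Fact symmx_addC : commutative symmx_add.
Proof. by move=> A B; apply/val_inj/ffunP=> ij; rewrite !ffunE addrC. Qed.

Fact symmx_add0 : left_id symmx_zero symmx_add.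
Proof. by move=> A; apply/val_inj/ffunP=> ij; rewrite !ffunE add0r. Qed.

Fact symmx_addN : left_inverse symmx_zero symmx_opp symmx_add.
Proof. by move=> A; apply/val_inj/ffunP=> ij; rewrite !ffunE addNr. Qed.

HB.instance Definition _ := GRing.isZmodule.Build symmx
  symmx_addA symmx_addC symmx_add0 symmx_addN.

(* v A v^T modulo 2 ^ k, computed with natural number representatives. *)
Definition symmx_form A (v : 'rV['Z_2]_m) : nat :=
  ((\sum_(i < m) A (i, i) * v 0%R i +
    2 * \sum_(i < m) \sum_(j < m | i < j) A (i, j) * v 0%R i * v 0%R j)
   %% 2 ^ k)%N.

Definition tau (R : realType) A : 'M[R[i]]_(2 ^ m) :=
  \sum_(v : 'rV['Z_2]_m) xi R k ^+ symmx_form A v *: (ket R v *m (ket R v) ^t*).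

Definition clifford_dsym (R : realType) : set 'M[R[i]]_(2 ^ m) :=
  [set U | exists A, U = tau R A].

End SymmetricMatrices.

Arguments tau {k m} R A.
Arguments clifford_dsym k m R : clear implicits.

(* Main.v *)
(** Write [chi_b v = (-1) ^ (b . v)] for the characters of Z_2^m.  The point is
that every matrix [e_v |-> xi_(k+1) ^ E(v) e_(v+a)] whose exponent
[E = sum_b c_b chi_b] is an integer combination of characters lies in level k of
the Clifford hierarchy.  Conjugating a Pauli matrix by it yields a matrix of the
same shape with exponent [E (v + a') - E v] up to signs; translation multiplies
each [chi_b] by a sign, so this difference is twice an integer combination of
characters, and [xi_(k+1) ^ 2 = xi_k].  At the bottom, [i ^ chi_b = i chi_b], so
that [i ^ E] is a power of i times a character.  The quadratic phases of the
[tau_R] have this form because [2 v_i = 1 - chi_i] and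
[4 v_i v_j = (1 - chi_i) (1 - chi_j)].

The map [R |-> tau_R] is multiplicative, and [R] is recovered from the phases at
the vectors [e_i] and [e_i + e_j], as [xi_k] is a primitive 2^k-th root of 1. *)
Require Import Defs.
From HB Require Import structures.
From mathcomp Require Import all_boot all_order all_algebra.
From mathcomp Require Import ring.
From mathcomp Require Import complex.
From mathcomp Require Import all_classical all_reals all_analysis.

Set Implicit Arguments.
Unset Strict Implicit.
Unset Printing Implicit Defensive.

Import Order.TTheory GRing.Theory Num.Theory.

Local Open Scope classical_set_scope.
Local Open Scope sesquilinear_scope.
Local Open Scope ring_scope.
Local Open Scope complex_scope.

(** * Roots of unity of two-power order *)

Section RootOfUnity.
Variable R : realType.

Lemma xiE k : xi R k = cos (2 * pi / 2 ^+ k) +i* sin (2 * pi / 2 ^+ k).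
Proof.
rewrite /xi /cexp.
have -> : 2 * pi%:C * 'i%R / 2 ^+ k = 0 +i* (2 * pi / 2 ^+ k) :> R[i].
  have -> : 2 ^+ k = (2 ^+ k)%:C :> R[i] by rewrite rmorphXn rmorph_nat.
  have -> : 2 = 2%:C :> R[i] by rewrite rmorph_nat.
  rewrite -complexiE -fmorphV -!rmorphM /=.
  by apply/eqP; rewrite eq_complex /=; apply/andP; split; apply/eqP; ring.
by rewrite /= expR0 mul1r.
Qed.

Lemma xi_sqr k : xi R k.+1 ^+ 2 = xi R k.
Proof.
rewrite !xiE.
have -> : 2 * pi / 2 ^+ k = 2 * pi / 2 ^+ k.+1 + 2 * pi / 2 ^+ k.+1 :> R.
  by rewrite exprS; field; rewrite expf_neq0// pnatr_eq0.
rewrite cosD sinD expr2; apply/eqP; rewrite eq_complex /=.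
by apply/andP; split; apply/eqP; ring.
Qed.

Lemma xi1 : xi R 1 = -1.
Proof.
rewrite xiE expr1 mulrAC divff ?pnatr_eq0// mul1r cospi sinpi.
by apply/eqP; rewrite eq_complex /= oppr0 !eqxx.
Qed.

Lemma xi2 : xi R 2 = 'i%R.
Proof.
rewrite xiE -complexiE expr2 -mulf_div divff ?pnatr_eq0// mul1r.
by rewrite cos_pihalf sin_pihalf.
Qed.

Lemma xi_expr2n k n : xi R (k + n) ^+ (2 ^ n) = xi R k.
Proof.
elim: n => [|n IHn]; first by rewrite addn0 expr1.
by rewrite addnS expnS exprM xi_sqr.
Qed.

(** The order divides 2^k, so it is some 2^e. If e < k, the power with exponent 2^(k-1) would be 1,
    but it equals [xi R 1], which is -1. *)
Lemma prim_root_xi k : (2 ^ k).-primitive_root (xi R k).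
Proof.
have xiK : xi R k ^+ (2 ^ k) = 1.
  by rewrite -{1}[k]add0n xi_expr2n -xi_sqr xi1 sqrrN expr1n.
have [d dprim dvd_d] := prim_order_exists (expn_gt0 2 k) xiK.
have [e le_ek Dd] := dvdn_pfactor d k (isT : prime 2) dvd_d.
move: le_ek; rewrite leq_eqVlt => /predU1P[ek|lt_ek].
  by rewrite ek in Dd; rewrite -Dd.
have: xi R k ^+ (2 ^ k.-1) = 1.
  apply/eqP; rewrite -(prim_order_dvd dprim) Dd dvdn_exp2l //.
  by rewrite -ltnS (ltn_predK lt_ek).
rewrite -{1}(ltn_predK lt_ek) -add1n xi_expr2n xi1 => /eqP.
by rewrite -subr_eq0 -opprD oppr_eq0 -(natrD _ 1 1) pnatr_eq0.
Qed.

Lemma xi_neq0 k : xi R k != 0.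
Proof.
apply/eqP => xi0; have := prim_expr_order (prim_root_xi k).
by move/eqP; rewrite xi0 expr0n expn_eq0 /= eq_sym oner_eq0.
Qed.

Lemma conj_xi k : (xi R k)^*%R = (xi R k)^-1.
Proof.
have : `|xi R k| ^+ (2 ^ k) = 1.
  by rewrite -normrX (prim_expr_order (prim_root_xi k)) normr1.
move/eqP; rewrite pexpr_eq1 ?expn_gt0 // => /eqP nxi.
by rewrite invC_norm nxi expr1n invr1 mul1r.
Qed.

End RootOfUnity.

Lemma Z2_eq01 (x : 'Z_2) : x = 0 \/ x = 1.
Proof. by case: x => [[|[|//]] lt_x]; [left|right]; apply: val_inj. Qed.

(** * Characters of Z_2^m and their integer combinations *)

Section Characters.
Variable m : nat.
Implicit Types (a b v : 'rV['Z_2]_m) (E F : 'rV['Z_2]_m -> int).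

(** Integer-valued, because characters also serve as exponents of roots of unity. *)
Definition chi b v : int := \prod_(i < m) (-1) ^+ (b 0%R i * v 0%R i)%N.

Lemma chiC b v : chi b v = chi v b.
Proof. by apply: eq_bigr => i _; rewrite mulnC. Qed.

Lemma chiDr b u v : chi b (u + v) = chi b u * chi b v.
Proof.
rewrite -big_split /=; apply: eq_bigr => i _; rewrite !mxE -exprD.
by case: (Z2_eq01 (b 0 i)) (Z2_eq01 (u 0 i)) (Z2_eq01 (v 0 i)) => -> [] -> [] ->.
Qed.

Lemma chiDl b c v : chi (b + c) v = chi b v * chi c v.
Proof. by rewrite !(chiC _ v) chiDr. Qed.

Lemma chi0 v : chi 0 v = 1.
Proof. by apply: big1 => i _; rewrite mxE mul0n. Qed.

Lemma chi_sign b v : chi b v = 1 \/ chi b v = -1.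
Proof.
rewrite /chi; elim/big_ind: _ => [|_ _ [->|->] [->|->]|i _]; rewrite ?mulrNN ?mul1r.
- by left.
- by left.
- by right.
- by right; rewrite mulr1.
- by left.
- by rewrite -signr_odd; case: odd; [right|left].
Qed.

Lemma chi_delta i v : chi (delta_mx 0 i) v = 1 - 2 * (v 0 i : nat)%:Z.
Proof.
rewrite /chi (bigD1 i) //= big1 => [|j /negPf ji]; last first.
  by rewrite mxE ji andbF mul0n.
by rewrite mxE !eqxx mulr1; case: (Z2_eq01 (v 0 i)) => ->.
Qed.

(* Integrality of the coefficients is the content: integer combinations of
   characters form a proper subgroup of the integer-valued functions. *)
Definition walsh E :=
  exists c : 'rV['Z_2]_m -> int, forall v, E v = \sum_b c b * chi b v.

Lemma walsh_chi b : walsh (chi b).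
Proof.
exists (fun b' => (b' == b)%:Z) => v.
by rewrite (bigD1 b) //= big1 ?addr0 ?eqxx ?mul1r // => c /negPf->; rewrite mul0r.
Qed.

Lemma walshD E F : walsh E -> walsh F -> walsh (fun v => E v + F v).
Proof.
move=> [c Ec] [d Fd]; exists (fun b => c b + d b) => v.
by rewrite Ec Fd -big_split; apply: eq_bigr => b _; rewrite mulrDl.
Qed.

Lemma walshZ n E : walsh E -> walsh (fun v => n * E v).
Proof.
move=> [c Ec]; exists (fun b => n * c b) => v.
by rewrite Ec mulr_sumr; apply: eq_bigr => b _; rewrite mulrA.
Qed.

Lemma walsh_cst n : walsh (fun=> n).
Proof.
have [c Ec] := walshZ n (walsh_chi 0).
by exists c => v; rewrite -Ec chi0 mulr1.
Qed.

Lemma walshB E F : walsh E -> walsh F -> walsh (fun v => E v - F v).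
Proof.
move=> wE wF; have [c Ec] := walshD wE (walshZ (-1) wF).
by exists c => v; rewrite -Ec mulN1r.
Qed.

Lemma walsh_sum (I : Type) (r : seq I) (P : pred I) (E : I -> 'rV['Z_2]_m -> int) :
  (forall i, P i -> walsh (E i)) -> walsh (fun v => \sum_(i <- r | P i) E i v).
Proof.
move=> wE; elim: r => [|i r [c Ec]].
  by have [c Ec] := walsh_cst 0; exists c => v; rewrite big_nil -Ec.
case Pi: (P i); last by exists c => v; rewrite big_cons Pi.
have [d Ed] := walshD (wE i Pi) (ex_intro _ c Ec).
by exists d => v; rewrite big_cons Pi -Ed.
Qed.

Lemma walsh_shift a E : walsh E -> walsh (fun v => E (v + a)).
Proof.
move=> [c Ec]; exists (fun b => c b * chi b a) => v.
by rewrite Ec; apply: eq_bigr => b _; rewrite chiDr mulrAC mulrA.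
Qed.

(* Each character is multiplied by a sign under translation, so that it changes
   by 0 or by -2 times itself. *)
Lemma walsh_half_diff a E : walsh E ->
  exists2 F, walsh F & forall v, E (v + a) - E v = 2 * F v.
Proof.
move=> [c Ec]; pose d b : int := if chi b a == 1 then 0 else - c b.
exists (fun v => \sum_b d b * chi b v); first by exists d.
move=> v; rewrite !Ec -sumrB mulr_sumr; apply: eq_bigr => b _.
by rewrite chiDr /d; case: (chi_sign b a) => ->; rewrite /=; ring.
Qed.

End Characters.

(** * Weighted translations of the basis, with the Pauli matrices among them *)

Section WeightedShifts.
Variables (R : realType) (m : nat).
Local Notation C := R[i].
Implicit Types (a b v : 'rV['Z_2]_m) (f g : 'rV['Z_2]_m -> C).

(* The operator e_v |-> f(v) e_(v+a). *)
Definition wshift a f : 'M[C]_(2 ^ m) :=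
  \matrix_(x, y) (f (label y) *+ (label x == label y + a)).

Lemma eq_wshift a f g : f =1 g -> wshift a f = wshift a g.
Proof. by move=> fg; apply/matrixP => x y; rewrite !mxE fg. Qed.

Lemma addvv v : v + v = 0.
Proof.
apply/rowP => i; rewrite !mxE.
by case: (Z2_eq01 (v 0 i)) => ->; apply: val_inj.
Qed.

Lemma addvK a : involutive (fun v => v + a).
Proof. by move=> v; rewrite -addrA addvv addr0. Qed.

Lemma mul_wshift a b f g :
  wshift a f *m wshift b g = wshift (a + b) (fun v => f (v + b) * g v).
Proof.
have [unlabel labelK unlabelK] := label_bij m.
apply/matrixP => x y; rewrite !mxE (bigD1 (unlabel (label y + b))) //= big1.
  rewrite !mxE unlabelK eqxx addr0 mulr1n mulrnAl.
  by congr (_ *+ (_ == _)); rewrite -addrA (addrC a).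
move=> z zNy; rewrite !mxE; case: eqP => [_|_]; last by rewrite mul0r.
case: eqP => [zy|_]; last by rewrite mulr0.
by case/eqP: zNy; rewrite -zy labelK.
Qed.

Lemma wshift01 : wshift 0 (fun=> 1) = 1%:M.
Proof.
apply/matrixP => x y; rewrite !mxE addr0.
by rewrite (inj_eq (bij_inj (label_bij m))).
Qed.

Lemma adj_wshift a f : (wshift a f) ^t* = wshift a (fun v => (f (v + a))^*%R).
Proof.
apply/matrixP => x y; rewrite !mxE rmorphMn.
have -> : (label y == label x + a) = (label x == label y + a).
  by rewrite eq_sym (can2_eq (addvK a) (addvK a)).
by case: eqP => [->|_]; rewrite ?addvK.
Qed.

Lemma wshift_unitary a f : (forall v, f v * (f v)^*%R = 1) -> wshift a f \is unitarymx.
Proof.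
move=> nf; apply/unitarymxP; rewrite adj_wshift mul_wshift addvv -wshift01.
by apply: eq_wshift.
Qed.

Lemma wshift_is_diag f : is_diag_mx (wshift 0 f).
Proof.
apply/is_diag_mxP => x y xNy; rewrite mxE addr0.
rewrite (inj_eq (bij_inj (label_bij m))).
by rewrite -val_eqE (negPf xNy).
Qed.

Lemma wshift0_inj f g : wshift 0 f = wshift 0 g -> f =1 g.
Proof.
have [unlabel _ unlabelK] := label_bij m.
move=> /matrixP fg v; have := fg (unlabel v) (unlabel v).
by rewrite !mxE unlabelK addr0 eqxx.
Qed.

Lemma pauliX_expE (a i j : 'Z_2) : (pauliX R ^+ a) i j = (i == j + a)%:R.
Proof.
case: (Z2_eq01 a) => ->; first by rewrite expr0 mxE addr0.
rewrite expr1 mxE; congr (_%:R).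
by case: (Z2_eq01 i) => ->; case: (Z2_eq01 j) => ->.
Qed.

Lemma pauliZ_expE (b i j : 'Z_2) :
  (pauliZ R ^+ b) i j = (-1) ^+ (b * i)%N *+ (i == j).
Proof.
case: (Z2_eq01 b) => ->; first by rewrite expr0 mxE mul0n.
by rewrite expr1 mxE mul1n.
Qed.

Lemma pauliDE a b : pauliD R a b = wshift a (fun v => (chi b v)%:~R).
Proof.
apply/matrixP => x y; rewrite !mxE rmorph_prod /=.
have pauliE i : (pauliX R ^+ a 0 i *m pauliZ R ^+ b 0 i) (label x 0 i) (label y 0 i) =
    (-1) ^+ (b 0%R i * label y 0%R i)%N *+ (label x 0 i == (label y + a) 0 i).
  rewrite mxE (bigD1 (label y 0 i)) //= big1 => [|j jNy].
    by rewrite pauliX_expE pauliZ_expE eqxx [(_ + a) 0 i]mxE addr0 mulr1n mulr_natl.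
  by rewrite pauliZ_expE (negPf jNy) mulr0n mulr0.
under eq_bigr do rewrite pauliE.
case: eqP => [->|xNy].
  by apply: eq_bigr => i _; rewrite eqxx mulr1n rmorphXn rmorphN1.
(* One mismatched coordinate makes the whole product of tensor factors vanish. *)
have [i xNyi] : exists i, label x 0 i != (label y + a) 0 i.
  apply/existsP; rewrite -negb_forall; apply/forallP => xy; apply: xNy.
  by apply/rowP => i; apply/eqP.
by rewrite (bigD1 i) //= (negPf xNyi) mulr0n mul0r.
Qed.

End WeightedShifts.

(** * Weighted shifts in the Clifford hierarchy *)

Section Hierarchy.
Variables (R : realType) (m : nat).
Local Notation C := R[i].
Implicit Types (a b v : 'rV['Z_2]_m) (E : 'rV['Z_2]_m -> int).

Lemma conj_xiz k (n : int) : (xi R k ^ n)^*%R = xi R k ^ (- n).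
Proof.
rewrite -exprz_inv -conj_xi.
exact: (fmorphXz (Num.conj : {rmorphism C -> C}) n (xi R k)).
Qed.

Lemma xi_exp_unit k (n : int) : xi R k ^ n * (xi R k ^ n)^*%R = 1.
Proof. by rewrite conj_xiz -expfzDr ?xi_neq0 // subrr expr0z. Qed.

Lemma expi_chi b v : 'i%R ^ chi b v = 'i%R * (chi b v)%:~R :> C.
Proof.
case: (chi_sign b v) => ->; first by rewrite expr1z mulr1.
by rewrite exprN1 invCi mulrN1.
Qed.

Lemma expfz_sum (I : Type) (r : seq I) (F : fieldType) (x : F) (n : I -> int) :
  x != 0 -> x ^ (\sum_(i <- r) n i) = \prod_(i <- r) x ^ n i.
Proof.
move=> x0; elim/big_ind2: _ => // p s q t <- <-.
by rewrite expfzDr.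
Qed.

Lemma chi_mulrz b (n : int) v : (chi (b *~ n) v)%:~R = (chi b v)%:~R ^ n :> C.
Proof.
have chiMn i : (chi (b *+ i) v)%:~R = (chi b v)%:~R ^+ i :> C.
  by elim: i => [|i IHi]; rewrite ?mulr0n ?chi0 // mulrS chiDl exprS intrM IHi.
case: n => n; first exact: chiMn.
(* For negative multiples: -b = b in Z_2^m, and a sign is its own inverse. *)
rewrite NegzE mulrNz (_ : - _ = b *+ n.+1); last first.
  by apply/eqP; rewrite eq_sym -addr_eq0 addvv.
rewrite chiMn -exprz_inv -exprnP; congr (_ ^+ _).
by case: (chi_sign b v) => ->; rewrite ?invr1 // rmorphN1 invrN1.
Qed.

(** Each term contributes (i chi_b)^(c_b). In the product over b, the powers of i add up to the sum
    of the c_b, taken modulo 4, and the characters combine into the one indexed by the sum of the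
    c_b b. *)
Lemma expi_walsh E : walsh E ->
  exists (kappa : 'Z_4) b, forall v, 'i%R ^ E v = 'i%R ^+ kappa * (chi b v)%:~R :> C.
Proof.
move=> [c Ec]; pose n := \sum_b c b.
exists (inZp `|(n %% 4)%Z|%N), (\sum_b b *~ c b) => v.
have i4 : 'i%R ^+ 4 = 1 :> C by rewrite (exprM _ 2 2) sqrCi sqrrN expr1n.
have -> : (chi (\sum_b b *~ c b) v)%:~R = \prod_b (chi b v)%:~R ^ c b :> C.
  elim/big_ind2: _ => [|b1 z1 b2 z2 <- <-|b _]; first by rewrite chi0.
    by rewrite chiDl intrM.
  by rewrite chi_mulrz.
have -> : 'i%R ^+ inZp (p' := 3) `|(n %% 4)%Z|%N = 'i%R ^ n :> C.
  rewrite /= expr_mod // exprnP gez0_abs ?modz_ge0 //.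
  rewrite [in RHS](divz_eq n 4) [RHS]expfzDr ?neq0Ci // (mulrC _ 4).
  by rewrite -exprz_exp -(exprnP _ 4) i4 exp1rz mul1r.
rewrite Ec !expfz_sum ?neq0Ci // -big_split /=; apply: eq_bigr => b _.
by rewrite mulrC -exprz_exp expi_chi expfzMl.
Qed.

(* The root of unity at level k of the hierarchy is xi (k + 1); both indices are
   shifted by one here. *)
Lemma wshift_clifford k a E : walsh E ->
  clifford R m k.+1 (wshift a (fun v => xi R k.+2 ^ E v)).
Proof.
elim: k a E => [|k IHk] a E wE.
  have [kappa [b Eb]] := expi_walsh wE.
  exists kappa, a, b; rewrite pauliDE xi2.
  by apply/matrixP => x y; rewrite !mxE mulrnAr Eb.
split; first by apply: wshift_unitary => v; rewrite xi_exp_unit.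
move=> a' b.
have [F wF EF] := walsh_half_diff a' (walsh_shift a wE).
(* The second term absorbs the sign of the Pauli matrix: the 2^k-th power of [xi R k.+2] is i, and
   i^(1 - s) = s for s = 1 or -1. *)
pose G v := F v + (2 ^ k)%N%:Z * (1 - chi b (v + a)).
have wG : walsh G.
  apply: walshD wF (walshZ _ (walshB (walsh_cst m 1) _)).
  exact: walsh_shift (walsh_chi b).
(* The two shifts by [a] cancel, as a + a = 0, so the conjugate shifts by [a'] alone. *)
rewrite pauliDE adj_wshift !mul_wshift (addrC a) -addrA addvv addr0.
set U := wshift _ _.
suff -> : U = wshift a' (fun v => xi R k.+2 ^ G v) by apply: IHk.
apply: eq_wshift => v.
rewrite conj_xiz mulrAC -expfzDr ?xi_neq0 // (addrAC v) EF.
have -> : xi R k.+3 ^ (2 * F v) = xi R k.+2 ^ F v.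
  by rewrite -exprz_exp -(exprnP _ 2) xi_sqr.
rewrite /G expfzDr ?xi_neq0 // -[in RHS]exprz_exp -[in RHS]exprnP.
rewrite -[in X in _ = _ * X]add2n xi_expr2n xi2.
case: (chi_sign b (v + a)) => ->; first by rewrite subrr expr0z.
by rewrite opprK -(exprnP _ 2) sqrCi rmorphN1.
Qed.

End Hierarchy.

(** * The phases of tau_R and their dependence on the entries of R *)

Section SymmetricPhases.
Variables (R : realType) (m k : nat).
Local Notation C := R[i].
Implicit Types (A B : symmx k m) (v : 'rV['Z_2]_m) (i j : 'I_m).

Definition phase A v : C := xi R k ^+ symmx_form A v.

Lemma tauE A : tau R A = wshift 0 (phase A).
Proof.
apply/matrixP => x y; rewrite summxE (bigD1 (label y)) //= big1 => [|v vNy].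
  by rewrite !mxE big_ord1 !mxE eqxx conjC1 mulr1 !addr0 mulr_natr.
rewrite !mxE big_ord1 !mxE [label y == v]eq_sym (negPf vNy).
by rewrite conjC0 !mulr0.
Qed.

Lemma walsh_phase A : exists2 E, walsh E & forall v, phase A v = xi R k.+1 ^ E v.
Proof.
pose u i v : int := 1 - chi (delta_mx 0 i) v.
exists (fun v => \sum_(i < m) (A (i, i) : nat)%:Z * u i v +
  \sum_(i < m) \sum_(j < m | (i < j)%N) (A (i, j) : nat)%:Z * (u i v * u j v)).
  have w1 i : walsh (u i) by exact: walshB (walsh_cst m 1) (walsh_chi _).
  (* (1 - chi_i) (1 - chi_j) = (1 - chi_i) - (chi_j - chi_(i+j)), as characters multiply by adding
     their indices. *)
  have w2 i j : walsh (fun v => u i v * u j v).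
    have [c Ec] := walshB (w1 i) (walshB (walsh_chi (delta_mx 0 j))
      (walsh_chi (delta_mx 0 i + delta_mx 0 j))).
    by exists c => v; rewrite -Ec /u chiDl; ring.
  apply: walshD; apply: walsh_sum => i _; first exact: walshZ.
  by apply: walsh_sum => j _; exact: walshZ.
move=> v; rewrite /phase /symmx_form (prim_expr_mod (prim_root_xi R k)).
(* Passing from [xi R k] to [xi R k.+1] doubles the exponent, which supplies the factors in 2 v_i =
   u_i and 4 v_i v_j = u_i u_j. *)
rewrite -xi_sqr -exprM exprnP; congr (_ ^ _).
rewrite PoszM PoszD PoszM mulrDr mulrA !(big_morph Posz PoszD (erefl 0%:Z)).
rewrite !mulr_sumr; congr (_ + _); apply: eq_bigr => i _.
  by rewrite PoszM /u chi_delta; ring.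
rewrite (big_morph Posz PoszD (erefl 0%:Z)) mulr_sumr; apply: eq_bigr => j _.
by rewrite !PoszM /u !chi_delta; ring.
Qed.

Hypothesis k_gt0 : (0 < k)%N.

(* xi k.-1 = xi k ^+ 2 accounts for the factor 2 of the off-diagonal terms of
   v A v^T. *)
Definition theta A i j : C := xi R (if i == j then k else k.-1) ^+ A (i, j).

(** The modulus of each entry is exactly the order of the root of unity raised to it in [theta].
    This makes [theta] additive and faithful in the entry; for k = 1 the off-diagonal modulus is 1
    and the root is 1. *)
Lemma theta_mod i j : (sym_modulus k i j).-1.+1 = (2 ^ if i == j then k else k.-1)%N.
Proof. by rewrite /sym_modulus (subn1 k); case: ifP => _; rewrite prednK ?expn_gt0. Qed.

Lemma thetaD A B i j : theta (A + B) i j = theta A i j * theta B i j.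
Proof.
rewrite /theta ffunE -exprD /=.
by rewrite expr_mod // theta_mod; exact: prim_expr_order (prim_root_xi R _).
Qed.

Lemma theta_eq1 A i j : theta A i j = 1 -> A (i, j) = 0.
Proof.
move=> th1; apply/val_inj => /=; apply/eqP.
have lt_A : (A (i, j) < 2 ^ if i == j then k else k.-1)%N.
  by rewrite -theta_mod; apply: ltn_ord.
move/eqP: th1; rewrite /theta -(prim_order_dvd (prim_root_xi R _)).
by rewrite /dvdn modn_small.
Qed.

(** One factor per entry of [A] on or above the diagonal, which reduces additivity and injectivity
    to single entries. *)
Lemma phaseE A v : phase A v =
  (\prod_(i < m) theta A i i ^+ v 0 i) *
  \prod_(i < m) \prod_(j < m | (i < j)%N) theta A i j ^+ (v 0%R i * v 0%R j)%N.
Proof.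
rewrite /phase /symmx_form (prim_expr_mod (prim_root_xi R k)) exprD exprM.
have -> : xi R k ^+ 2 = xi R k.-1 by rewrite -[in RHS]xi_sqr prednK.
rewrite !expr_sum; congr (_ * _); apply: eq_bigr => i _.
  by rewrite /theta eqxx exprM.
rewrite expr_sum; apply: eq_bigr => j lt_ij.
by rewrite /theta -val_eqE (ltn_eqF lt_ij) -mulnA exprM.
Qed.

Lemma phaseD A B v : phase (A + B) v = phase A v * phase B v.
Proof.
rewrite !phaseE mulrACA; congr (_ * _); rewrite -big_split; apply: eq_bigr => i _.
  by rewrite /= thetaD exprMn.
by rewrite -big_split; apply: eq_bigr => j _; rewrite /= thetaD exprMn.
Qed.

(** By additivity the value is idempotent, and it is nonzero. *)
Lemma phase0 v : phase 0 v = 1.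
Proof.
have := phaseD 0 0 v; rewrite addr0 -{1}[phase 0 v]mulr1 => /mulfI <- //.
by rewrite /phase expf_neq0 // xi_neq0.
Qed.

(** The vector e_i isolates the diagonal factor at i. Once the diagonal factors are 1, e_i + e_j
    isolates the factor at (i, j). Symmetry then gives the entries below the diagonal. *)
Lemma phase_eq1 A : (forall v, phase A v = 1) -> A = 0.
Proof.
move=> A1.
have diag1 i : theta A i i = 1.
  rewrite -(A1 (delta_mx 0 i)) phaseE (bigD1 i) //= !mxE !eqxx expr1.
  rewrite big1 => [|j /negPf ji]; last by rewrite mxE ji andbF expr0.
  rewrite !mulr1 big1 ?mulr1 // => j _; apply: big1 => l lt_jl; rewrite !mxE /=.
  have [ji|_] := eqVneq j i; last by rewrite mul0n.
  by rewrite -ji -val_eqE gtn_eqF // muln0.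
have off1 i j : (i < j)%N -> theta A i j = 1.
  move=> lt_ij; pose v : 'rV['Z_2]_m := delta_mx 0 i + delta_mx 0 j.
  have vE l : v 0 l = (l == i) || (l == j) :> nat.
    rewrite !mxE /=; have [->|_] := eqVneq l i; last by case: (l == j).
    by rewrite -val_eqE ltn_eqF.
  rewrite -(A1 v) phaseE big1 => [|l _]; last by rewrite diag1 expr1n.
  rewrite mul1r (bigD1 i) //= (bigD1 j) //= !vE !eqxx orbT expr1.
  rewrite !big1 ?mulr1 // => [l|l /andP[lt_il /negPf lj]].
    move=> /negPf li; apply: big1 => n lt_ln; rewrite !vE li /=.
    have [lj|_] := eqVneq l j; last by rewrite mul0n.
    rewrite -!val_eqE /= !gtn_eqF ?muln0 //; first by rewrite -lj.
    by rewrite (ltn_trans lt_ij) // -lj.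
  by rewrite !vE lj orbF -[l == i]val_eqE gtn_eqF // muln0.
have ij0 i j : (i <= j)%N -> A (i, j) = 0.
  by rewrite leq_eqVlt => /predU1P[/val_inj->|/off1]; apply: theta_eq1 => //.
apply/val_inj/ffunP => -[i j]; rewrite ffunE.
have [/ij0 //|/ltnW/ij0 ji0] := leqP i j.
by apply/val_inj; rewrite /= symmxC ji0.
Qed.

Lemma tauD A B : tau R (A + B) = tau R A *m tau R B.
Proof.
rewrite !tauE mul_wshift addr0; apply: eq_wshift => v.
by rewrite phaseD addr0.
Qed.

Lemma tau0 : tau R (0 : symmx k m) = 1%:M.
Proof. by rewrite tauE -wshift01; apply: eq_wshift; exact: phase0. Qed.

Lemma tauN A : tau R (- A) = invmx (tau R A).
Proof.
have AN : tau R A *m tau R (- A) = 1%:M by rewrite -tauD subrr tau0.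
have [uA _] := mulmx1_unit AN.
by rewrite -[LHS](mulKmx uA) AN mulmx1.
Qed.

(** By additivity a trivial kernel suffices. *)
Lemma tau_inj : injective (fun A : symmx k m => tau R A).
Proof.
move=> A B eqAB; apply/eqP; rewrite -subr_eq0; apply/eqP/phase_eq1.
apply: (@wshift0_inj R m _ (fun=> 1)).
by rewrite wshift01 -tauE tauD /= eqAB -tauD subrr tau0.
Qed.

Lemma tau_clifford_diag A : clifford_diag R m k (tau R A).
Proof.
rewrite tauE; split; last exact: wshift_is_diag.
have [E wE phE] := walsh_phase A; rewrite (eq_wshift _ phE).
by rewrite -[k](prednK k_gt0); exact: wshift_clifford.
Qed.

End SymmetricPhases.

(** * The subgroup of phases and its isomorphism with symmetric matrices *)

Theorem theorem11 (R : realType) (m k : nat) (hm : (1 <= m)%N) (hk : (1 <= k)%N) :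
  mx_subgroup (clifford_dsym k m R) (clifford_diag R m k) /\
  exists gamma : 'M[R[i]]_(2 ^ m) -> symmx k m,
    [/\ forall A : symmx k m, gamma (tau R A) = A,
        set_bij (clifford_dsym k m R) setT gamma &
        forall U V : 'M[R[i]]_(2 ^ m),
          clifford_dsym k m R U -> clifford_dsym k m R V ->
          gamma (U *m V) = gamma U + gamma V].
Proof.
split.
  split=> [_ [A ->]||_ _ [A ->] [B ->]|_ [A ->]].
  - exact: tau_clifford_diag.
  - by exists 0; rewrite tau0.
  - by exists (A + B); rewrite tauD.
  - by exists (- A); rewrite tauN.
(* A preimage under [tau] is chosen, unique by injectivity; 0 is a default value outside the
   image. *)
pose gamma U := if pselect (clifford_dsym k m R U) is left UA
  then projT1 (cid UA) else 0.
have gammaK A : gamma (tau R A) = A.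
  rewrite /gamma; case: pselect => [tA|[]]; last by exists A.
  by apply: (tau_inj (R := R) hk); rewrite -(projT2 (cid tA)).
exists gamma; split=> [//||_ _ [A ->] [B ->]]; last by rewrite -tauD // !gammaK.
split=> [//||A _].
  by move=> _ _ /set_mem[A ->] /set_mem[B ->]; rewrite !gammaK => ->.
by exists (tau R A); [exists A|exact: gammaK].
Qed.
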